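(* Let $d > 2$ be an integer, let $\alpha$ be a real number with $2(d-1)-1 < \alpha < 2(d-1)+1$, and let $n$ be a positive integer. There is a constant $c > 0$, independent of $F$ and of $\mathbf{L}$ (it may depend on $d$, $\alpha$, $n$), such that the following holds. Let $F$ be a finite field and let $\mathbf{L}$ be a collection (set) of lines in $F^n$ with $|\mathbf{L}| \geq |F|^{\alpha}$. If $\mathbf{L}$ satisfies the $d$-plane Wolff axiom, then $$\Big|\bigcup_{L \in \mathbf{L}} L\Big| \geq c\,|F|^{\frac{\alpha+3}{2}}.$$
   Context: $|\cdot|$ denotes cardinality. A $k$-plane in $F^n$ is a translate of a $k$-dimensional linear subspace of $F^n$; a line is a $1$-plane. A set of lines $\mathbf{L}$ in $F^n$ satisfies the $d$-plane Wolff axiom if for every $d$-plane $R \subset F^n$ one has $|\{L \in \mathbf{L} : L \subset R\}| < |F|^{2d-3}$. *)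

(* Defs.v *)
From mathcomp Require Import all_boot all_order all_algebra.

Set Implicit Arguments.
Unset Strict Implicit.
Unset Printing Implicit Defensive.

Import GRing.Theory.
Local Open Scope ring_scope.

Definition is_plane (F : finFieldType) (n k : nat) (P : {set 'rV[F]_n}) : Prop :=
  exists (v : 'rV[F]_n) (V : {vspace 'rV[F]_n}),
    \dim V = k /\ P = [set v + u | u in V].

Definition is_line (F : finFieldType) (n : nat) (L : {set 'rV[F]_n}) : Prop :=
  is_plane 1 L.

(* The exponent uses truncated subtraction on nat, so it is the intended
   2d - 3 only for 2 <= d. *)
Definition plane_Wolff (F : finFieldType) (n d : nat)
    (LL : {set {set 'rV[F]_n}}) : Prop :=
  forall P : {set 'rV[F]_n}, is_plane d P ->
    (#|[set L in LL | L \subset P]| < #|F| ^ (2 * d - 3))%N.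

(* Main.v *)
Require Import Defs.
From mathcomp Require Import all_boot all_order all_algebra.
From mathcomp Require Import reals exp.
From mathcomp Require Import finfield zify lra boolp.

(** Write q for the size of the field, and call a set M of lines dense in a
    point set P when every line of M has at least q/a points in P, for some
    fixed a.  All bounds are inequalities between natural numbers, with
    constants that depend on a and on dimensions only.

    The engine is Wolff's hairbrush ([hairbrush]), thickened from a line to a
    plane.  Suppose an r-plane S has a positive proportion of its points in P,
    and each point of P lies on at least mu lines of M, with mu large compared
    with q^(r-1), the number of lines of S through a point.  Then about q^r mu
    lines of M meet S in one point each.  Each of them spans with S an
    (r+1)-plane, and the different (r+1)-planes through S are disjoint outside
    S.  If no (r+1)-plane contains more than q^(2r-1) lines of M, it is enough
    to know, inside each of them, that m <= q^(2r-1) lines cover at least about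
    m q^(2-r) points ([union_bound]); adding up gives |P| >= c mu q^2.

    A suitable S is found by taking r maximal such that some r-plane contains
    at least q^(2r-3) lines of M.  Such an r exists, since a line is a 1-plane
    that contains a line, and r < d by the d-plane Wolff axiom.  By maximality
    the (r+1)-planes contain few lines, while [union_bound] in dimension r-1
    shows that S is full ([full_plane]).  Double counting of incidences,
    together with [prune], allows one to take mu of order |M| q / |P|, whence
    |P|^2 >= c |M| q^3; the alternative that mu is too small for the hairbrush
    says that |P| >= c |M| q^(3-d).  This is [wolff_bound].  When
    |M| >= q^alpha with alpha >= 2d-3, both alternatives give
    |P| >= c q^((alpha+3)/2).

    The bounds [union_bound] are proved by induction on the dimension k
    ([line_unions_succ]).  If at least half of the lines lie in no k-plane that
    contains q^(2k-3) lines of M, then these lines satisfy the k-plane Wolff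
    axiom and [wolff_bound] applies.  Otherwise M is covered by many full
    k-planes, and since two of them share at most q^(k-1) points, Cordoba's
    argument ([cordoba]) bounds their union from below. *)

Set Implicit Arguments.
Unset Strict Implicit.
Unset Printing Implicit Defensive.

Import Order.TTheory GRing.Theory Num.Theory.
Local Open Scope nat_scope.

(** * Incidence counting *)

Lemma double_count (T U : finType) (r : T -> U -> bool)
    (X : {set T}) (Y : {set U}) :
  \sum_(x in X) #|[set y in Y | r x y]| = \sum_(y in Y) #|[set x in X | r x y]|.
Proof.
transitivity (\sum_(x in X) \sum_(y in Y | r x y) 1).
  by apply: eq_bigr => x _; rewrite sum1_card; apply: eq_card => y; rewrite !inE.
rewrite (exchange_big_dep (mem Y)) /=; last by move=> x y _ /andP[].
apply: eq_bigr => y Yy; rewrite sum1_card.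
by apply: eq_card => x; rewrite !inE unfold_in /= Yy.
Qed.

(** Deleting an x of degree below s/w, or a y of degree below t/w, does not
    decrease w times the number of incidences minus s|X| + t|Y|.  This quantity
    is positive at the start, so deletions stop before X is empty, and then all
    degrees are large. *)
Lemma prune (T U : finType) (r : T -> U -> bool) (w s t : nat)
    (X : {set T}) (Y : {set U}) :
  s * #|X| + t * #|Y| < w * \sum_(x in X) #|[set y in Y | r x y]| ->
  exists (X' : {set T}) (Y' : {set U}),
    [/\ X' \subset X, X' != set0, Y' \subset Y,
        forall x, x \in X' -> s <= w * #|[set y in Y' | r x y]| &
        forall y, y \in Y' -> t <= w * #|[set x in X' | r x y]|].
Proof.
have [N] := ubnP (#|X| + #|Y|); elim: N => // N IHN in X Y *.
move=> leN lt_w.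
have [/exists_inP[x Xx ltx] | /exists_inPn allX] :=
    boolP [exists x in X, w * #|[set y in Y | r x y]| < s].
  have := cardsD1 x X; rewrite Xx => cX.
  move: lt_w; rewrite (big_setD1 x Xx) /= => lt_w.
  have [||X' [Y' [sX' X'0 sY' hX hY]]] := IHN (X :\ x) Y; [lia | nia |].
  by exists X', Y'; split=> //; apply: subset_trans sX' (subsetDl _ _).
have [/exists_inP[y Yy lty] | /exists_inPn allY] :=
    boolP [exists y in Y, w * #|[set x in X | r x y]| < t].
  have := cardsD1 y Y; rewrite Yy => cY.
  move: lt_w; rewrite double_count (big_setD1 y Yy) /= -double_count => lt_w.
  have [||X' [Y' [sX' X'0 sY' hX hY]]] := IHN X (Y :\ y); [lia | nia |].
  by exists X', Y'; split=> //; apply: subset_trans sY' (subsetDl _ _).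
exists X, Y; split=> //.
- apply: contraTneq lt_w => ->; rewrite big_set0; lia.
- by move=> x /allX; rewrite -leqNgt.
- by move=> y /allY; rewrite -leqNgt.
Qed.

Lemma sum_sqr_le (T : finType) (P : {set T}) (f : T -> nat) :
  (\sum_(p in P) f p) ^ 2 <= #|P| * \sum_(p in P) f p ^ 2.
Proof.
rewrite -(leq_pmul2l (isT : 0 < 2)) -{1}mulnn big_distrlr /= big_distrr /=.
under eq_bigr => p _ do rewrite big_distrr /=.
have le1 : \sum_(p in P) \sum_(p' in P) 2 * (f p * f p') <=
          \sum_(p in P) \sum_(p' in P) (f p ^ 2 + f p' ^ 2).
  by apply: leq_sum => p _; apply: leq_sum => p' _; apply: nat_Cauchy.
apply: leq_trans le1 _.
under eq_bigr => p _ do rewrite big_split /= sum_nat_const.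
rewrite big_split /= -big_distrr /= sum_nat_const; lia.
Qed.

(** Cauchy-Schwarz on the multiplicity function p |-> #{S in A : p in S}: as A
    has at most x members, the off-diagonal part of its second moment is at
    most |A| x y, which is comparable to its first moment. *)
Lemma cordoba (T : finType) (A : {set {set T}}) (P : {set T}) (a x y : nat) :
  #|A| <= x ->
  (forall S, S \in A -> x * y <= a * #|S :&: P|) ->
  (forall S S', S \in A -> S' \in A -> S != S' -> #|S :&: S'| <= y) ->
  #|A| * (x * y) <= a * a.+1 * #|P|.
Proof.
move=> leAx big small; set I := \sum_(S in A) #|S :&: P|.
have leI : #|A| * (x * y) <= a * I.
  by rewrite /I big_distrr /= -sum_nat_const; apply: leq_sum.
have EI : I = \sum_(p in P) #|[set S in A | p \in S]|.
  rewrite -(double_count (fun (S : {set T}) p => p \in S)).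
  by apply: eq_bigr => S _; apply: eq_card => p; rewrite !inE andbC.
have E2 : \sum_(p in P) #|[set S in A | p \in S]| ^ 2 =
          \sum_(S in A) \sum_(S' in A) #|S :&: S' :&: P|.
  transitivity (\sum_(p in P) \sum_(S in A | p \in S) \sum_(S' in A | p \in S') 1).
    apply: eq_bigr => p _; under eq_bigr => S _ do rewrite sum1_card.
    rewrite sum_nat_const -mulnn; congr (_ * _); apply: eq_card => S.
      by rewrite inE.
    by rewrite inE.
  rewrite (exchange_big_dep (mem A)) /=; last by move=> ? ? _ /andP[].
  apply: eq_bigr => S SA.
  rewrite (exchange_big_dep (mem A)) /=; last by move=> ? ? _ /andP[].
  apply: eq_bigr => S' SA'; rewrite sum1_card.
  by apply: eq_card => p; rewrite !inE unfold_in /= SA SA' /=;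
     case: (p \in P); case: (p \in S); case: (p \in S').
(* the diagonal terms S = S' contribute I, all others at most |A|^2 y <= a I *)
have le2 : \sum_(p in P) #|[set S in A | p \in S]| ^ 2 <= I + a * I.
  rewrite E2; apply: (@leq_trans (\sum_(S in A) (#|S :&: P| + #|A| * y))).
    apply: leq_sum => S SA; rewrite (big_setD1 S) //= setIid leq_add2l.
    apply: (@leq_trans (\sum_(i in A :\ S) y)).
      apply: leq_sum => S'; rewrite !inE => /andP[neS S'A].
      apply: leq_trans (small S S' SA S'A _); last by rewrite eq_sym.
      exact/subset_leq_card/subsetIl.
    by rewrite sum_nat_const leq_mul2r (subset_leq_card (subsetDl _ _)) orbT.
  rewrite big_split /= sum_nat_const leq_add2l.
  by apply: leq_trans leI; rewrite leq_mul2l leq_mul2r leAx !orbT.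
have leI2 : I ^ 2 <= #|P| * (a.+1 * I).
  rewrite {1}EI; apply: leq_trans (sum_sqr_le _ _) _.
  by rewrite leq_mul2l mulSn le2 orbT.
apply: leq_trans leI _; rewrite -mulnA leq_mul2l; apply/orP; right.
by case: (posnP I) leI2 => [->|I0]; rewrite // -mulnn mulnA leq_pmul2r // mulnC.
Qed.

(** * Planes and lines in a finite affine space *)

(** Any point of a plane can serve as its origin. *)
Lemma planeP (F : finFieldType) (n k : nat) (P : {set 'rV[F]_n}) p :
  is_plane k P -> p \in P ->
  exists V : {vspace 'rV[F]_n},
    \dim V = k /\ P = [set x | (x - p)%R \in V].
Proof.
move=> [v [V [dV ->]]] /imsetP[u Vu ->]; exists V; split=> //.
apply/setP => x; rewrite inE; apply/imsetP/idP => [[w Vw ->]|Vx].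
  by rewrite opprD addrACA subrr add0r memvB.
exists (x - (v + u) + u)%R; first exact: memvD.
by rewrite addrC opprD !addrA addrNK addrNK.
Qed.

Lemma is_plane_translate (F : finFieldType) (n : nat) (V : {vspace 'rV[F]_n})
  p : is_plane (\dim V) [set x | (x - p)%R \in V].
Proof.
exists p, V; split=> //; apply/setP => x; rewrite inE.
apply/idP/imsetP => [Vx|[u Vu ->]]; last by rewrite addrC addKr.
by exists (x - p)%R; rewrite // addrC subrK.
Qed.

Lemma card_translate (F : finFieldType) (n : nat) (V : {vspace 'rV[F]_n}) p :
  #|[set x | (x - p)%R \in V]| = #|F| ^ \dim V.
Proof.
rewrite -card_vspace -(card_imset (mem V) (addIr p)); apply: eq_card => x.
rewrite inE; apply/idP/imsetP => [Vx|[u Vu ->]]; last by rewrite addrK.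
by exists (x - p)%R; rewrite // subrK.
Qed.

Lemma plane_nonempty (F : finFieldType) (n k : nat) (P : {set 'rV[F]_n}) :
  is_plane k P -> exists p, p \in P.
Proof.
by move=> [v [V [_ ->]]]; exists v; apply/imsetP; exists 0%R; rewrite ?mem0v ?addr0.
Qed.

Lemma card_plane (F : finFieldType) (n k : nat) (P : {set 'rV[F]_n}) :
  is_plane k P -> #|P| = #|F| ^ k.
Proof.
move=> plP; have [p Pp] := plane_nonempty plP.
by have [V [<- ->]] := planeP plP Pp; rewrite card_translate.
Qed.

Lemma card_plane_cap (F : finFieldType) (n j k : nat) (A B : {set 'rV[F]_n}) :
  is_plane k A -> is_plane j B -> ~~ (A \subset B) ->
  #|A :&: B| * #|F| <= #|F| ^ k.
Proof.
move=> plA plB nsAB; have [->|[p /setIP[Ap Bp]]] := set_0Vmem (A :&: B).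
  by rewrite cards0.
have [V [dV EA]] := planeP plA Ap; have [W [dW EB]] := planeP plB Bp.
have -> : A :&: B = [set x | (x - p)%R \in (V :&: W)%VS].
  by rewrite EA EB; apply/setP => x; rewrite !inE memv_cap.
rewrite card_translate -expnSr leq_pexp2l ?(ltnW (card_finNzRing_gt1 F)) //.
rewrite -dV ltnNge; apply: contra nsAB => le_dim.
have /eqP EV : (V :&: W == V)%VS by rewrite eqEdim capvSl.
by rewrite EA EB; apply/subsetP => x; rewrite !inE -EV memv_cap => /andP[].
Qed.

Lemma subset_plane_eq (F : finFieldType) (n k : nat) (A B : {set 'rV[F]_n}) :
  is_plane k A -> is_plane k B -> A \subset B -> A = B.
Proof.
move=> plA plB sAB; apply/eqP.
by rewrite eqEcard sAB (card_plane plA) (card_plane plB) leqnn.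
Qed.

Lemma card_plane_cap_neq (F : finFieldType) (n k : nat)
    (A B : {set 'rV[F]_n}) :
  is_plane k A -> is_plane k B -> A != B -> #|A :&: B| * #|F| <= #|F| ^ k.
Proof.
move=> plA plB neAB; apply: (card_plane_cap plA plB).
by apply: contra neAB => /(subset_plane_eq plA plB)->.
Qed.

Lemma card_line_cap (F : finFieldType) (n k : nat) (L S : {set 'rV[F]_n}) :
  is_line L -> is_plane k S -> ~~ (L \subset S) -> #|L :&: S| <= 1.
Proof.
move=> lL plS nsLS; have := card_plane_cap lL plS nsLS.
by rewrite expn1 -{2}[#|F|]mul1n leq_pmul2r // (ltnW (card_finNzRing_gt1 F)).
Qed.

Lemma card_lines_cap (F : finFieldType) (n : nat) (L M : {set 'rV[F]_n}) :
  is_line L -> is_line M -> L != M -> #|L :&: M| <= 1.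
Proof.
move=> lL lM neLM; apply: (card_line_cap lL lM).
by apply: contra neLM => /(subset_plane_eq lL lM)->.
Qed.

(** The direction of L meets that of S trivially, so the sum of the two
    directions has dimension r + 1. *)
Lemma plane_join_line (F : finFieldType) (n r : nat) (S L : {set 'rV[F]_n}) p :
  is_plane r S -> is_line L -> p \in S -> p \in L -> ~~ (L \subset S) ->
  exists R, [/\ is_plane r.+1 R, S \subset R & L \subset R].
Proof.
move=> plS lL Sp Lp nsLS.
have [V [dV ES]] := planeP plS Sp; have [W [dW EL]] := planeP lL Lp.
have dim0 : \dim (V :&: W) = 0.
  apply/eqP; rewrite -leqn0 -ltnS -[X in _ < X]dW ltnNge; apply: contra nsLS => le_dim.
  have /eqP EW : (V :&: W == W)%VS by rewrite eqEdim capvSr.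
  by rewrite EL ES; apply/subsetP => x; rewrite !inE -{1}EW memv_cap => /andP[].
exists [set x | (x - p)%R \in (V + W)%VS]; split.
- have := dimv_sum_cap V W; rewrite dim0 addn0 dV dW addn1 => <-.
  exact: is_plane_translate.
- by rewrite ES; apply/subsetP => x; rewrite !inE; apply/subvP/addvSl.
- by rewrite EL; apply/subsetP => x; rewrite !inE; apply/subvP/addvSr.
Qed.

(** Two distinct (r+1)-planes share at most q^r points, and those of S already
    account for all of them. *)
Lemma plane_succ_cap (F : finFieldType) (n r : nat) (S A B : {set 'rV[F]_n}) x :
  is_plane r S -> is_plane r.+1 A -> is_plane r.+1 B ->
  S \subset A -> S \subset B -> x \notin S -> x \in A -> x \in B -> A = B.
Proof.
move=> plS plA plB sSA sSB Sx Ax Bx; apply/eqP; apply: contraNT Sx => neAB.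
have := card_plane_cap_neq plA plB neAB.
rewrite expnSr leq_pmul2r ?(ltnW (card_finNzRing_gt1 F)) // -(card_plane plS).
have sS : S \subset A :&: B by rewrite subsetI sSA.
move=> leAB; have /eqP-> : S == A :&: B by rewrite eqEcard sS.
by rewrite inE Ax.
Qed.

(** The sharp count is (q^r - 1)/(q - 1): the lines through p partition the
    other points of S.  The factor 2 absorbs q/(q - 1). *)
Lemma card_lines_through (F : finFieldType) (n r : nat) (S : {set 'rV[F]_n}) p
    (M : {set {set 'rV[F]_n}}) :
  is_plane r S ->
  (forall L, L \in M -> [/\ is_line L, p \in L & L \subset S]) ->
  #|M| * #|F| <= 2 * #|F| ^ r.
Proof.
move=> plS hM; have q1 : 1 < #|F| := card_finNzRing_gt1 F.
have q2 : #|F| <= 2 * #|F|.-1 by lia.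
suff le1 : #|M| * #|F|.-1 <= #|F| ^ r.
  by apply: leq_trans (leq_mul (leqnn _) q2) _; rewrite mulnCA leq_mul2l le1.
rewrite -(card_plane plS) -sum_nat_const.
apply: (@leq_trans (\sum_(L in M) #|[set x in S :\ p | x \in L]|)).
  apply: leq_sum => L /hM[lL Lp sLS].
  have := cardsD1 p L; rewrite Lp (card_plane lL) expn1 => -> /=.
  by apply/subset_leq_card/subsetP => x; rewrite !inE => /andP[-> Lx];
     rewrite Lx (subsetP sLS).
rewrite (double_count (fun (L : {set 'rV[F]_n}) x => x \in L)).
apply: (@leq_trans (\sum_(x in S :\ p) 1)); last first.
  by rewrite sum1_card subset_leq_card // subsetDl.
apply: leq_sum => x; rewrite !inE => /andP[nxp Sx].
rewrite leqNgt; apply/negP => /card_gt1P[L [L' []]]; rewrite !inE.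
move=> /andP[/hM[lL Lp _] Lx] /andP[/hM[lL' Lp' _] Lx'] /(card_lines_cap lL lL').
rewrite leqNgt => /negP[]; apply/card_gt1P; exists p, x.
by rewrite !inE Lp Lp' Lx Lx' eq_sym.
Qed.

(** Each of the q^k points of S lies on at most 2 q^(k-1) of the lines, and each
    line has q points. *)
Lemma card_lines_in (F : finFieldType) (n k : nat) (S : {set 'rV[F]_n})
    (M : {set {set 'rV[F]_n}}) :
  is_plane k S ->
  (forall L, L \in M -> is_line L /\ L \subset S) ->
  #|M| * #|F| ^ 2 <= 2 * #|F| ^ (2 * k).
Proof.
move=> plS hM.
have : \sum_(L in M) #|[set x in S | x \in L]| = #|M| * #|F|.
  rewrite -sum_nat_const; apply: eq_bigr => L /hM[lL sLS].
  rewrite -[#|F|]expn1 -(card_plane lL); apply: eq_card => x; rewrite !inE.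
  by case Lx: (x \in L); rewrite ?andbT ?andbF // (subsetP sLS).
rewrite (double_count (fun (L : {set 'rV[F]_n}) x => x \in L)) => EM.
rewrite -mulnn mulnA -EM big_distrl /= [X in _ ^ X]mul2n -addnn expnD.
apply: (@leq_trans (\sum_(x in S) 2 * #|F| ^ k)).
  apply: leq_sum => x Sx; apply: (card_lines_through (p := x) plS) => L.
  by rewrite inE => /andP[/hM[lL sLS] Lx].
by rewrite sum_nat_const (card_plane plS) mulnCA.
Qed.

(** * The hairbrush of a plane *)

(** A weakening of M being a set of lines with union P, by a factor a on each
    line: this is what survives when points of P are discarded. *)
Definition dense_lines (F : finFieldType) (n a : nat)
    (M : {set {set 'rV[F]_n}}) (P : {set 'rV[F]_n}) : Prop :=
  forall L, L \in M -> is_line L /\ #|F| <= a * #|L :&: P|.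

(** The inequality reads |P| >= c |M| q^(2-r).  For |M| = q^(2(r-1)+beta) with
    0 <= beta <= 1 it is the sharp bound |P| >= c q^(r+beta); for at most
    q^(2r-3) lines it is weaker than the bound of the same form for r - 1. *)
Definition union_bound (F : finFieldType) (n a C r : nat) : Prop :=
  forall (M : {set {set 'rV[F]_n}}) (P : {set 'rV[F]_n}),
    dense_lines a M P -> #|M| <= #|F| ^ (2 * r - 1) ->
    #|M| * #|F| ^ 2 <= C * #|P| * #|F| ^ r.

Lemma dense_linesS (F : finFieldType) (n a : nat)
    (M N : {set {set 'rV[F]_n}}) (P : {set 'rV[F]_n}) :
  N \subset M -> dense_lines a M P -> dense_lines a N P.
Proof. by move=> /subsetP sNM hM L /sNM/hM. Qed.

Lemma dense_linesI (F : finFieldType) (n a : nat)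
    (M : {set {set 'rV[F]_n}}) (S P : {set 'rV[F]_n}) :
  dense_lines a M P ->
  dense_lines a [set L in M | L \subset S] (S :&: P).
Proof.
move=> hM L; rewrite inE => /andP[/hM[lL dL] /setIidPl sLS].
by split; rewrite // setIA sLS.
Qed.

(** With s the number of lines of M inside S through a point and g the number of
    the others: if s is small compared with h / D, then g is at least half of
    what h <= D (s + g) guarantees for the sum. *)
Lemma halve_degree h D s g q Q :
  0 < q -> h <= D * (s + g) -> s * q <= 2 * Q -> 4 * D * Q <= h * q ->
  h <= 2 * D * g.
Proof.
move=> q0 hle sle leh; rewrite -(leq_pmul2r q0).
have := leq_mul hle (leqnn q); have := leq_mul (leqnn D) sle; nia.
Qed.

(** The ratio h / D plays the role of the multiplicity mu of the points of P,
    kept as a fraction to stay within the natural numbers.  The lines of G are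
    the bristles; each is counted once among the incidences with the points of
    S, and loses at most one of its points when S is removed from P, which
    costs a factor 2 in density as 2a <= q. *)
Lemma hairbrush (F : finFieldType) (n r a C1 C2 D h : nat)
    (S : {set 'rV[F]_n}) (M : {set {set 'rV[F]_n}}) (P : {set 'rV[F]_n}) :
  is_plane r S -> dense_lines a M P -> 2 * a <= #|F| ->
  (forall p, p \in P -> h <= D * #|[set L in M | p \in L]|) ->
  4 * D * #|F| ^ r <= h * #|F| ->
  #|F| ^ r <= C1 * #|S :&: P| ->
  (forall R, is_plane r.+1 R ->
     #|[set L in M | L \subset R]| <= #|F| ^ (2 * r - 1)) ->
  union_bound F n (2 * a) C2 r ->
  h * #|F| ^ 2 <= 2 * D * C1 * C2 * #|P|.
Proof.
move=> plS dM le2a deg leD fullS wolff ub.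
have q1 : 1 < #|F| := card_finNzRing_gt1 F.
pose G := [set L in M | ~~ (L \subset S) & L :&: S :&: P != set0].
have leG : #|S :&: P| * h <= 2 * D * #|G|.
  apply: (@leq_trans (2 * D * \sum_(p in S :&: P) #|[set L in G | p \in L]|)).
    rewrite -sum_nat_const big_distrr /=; apply: leq_sum => p /setIP[Sp Pp].
    have leS : #|[set L in M | (p \in L) && (L \subset S)]| * #|F| <= 2 * #|F| ^ r.
      apply: (card_lines_through (p := p) plS) => L.
      by rewrite inE => /and3P[/dM[]].
    have degE : #|[set L in M | p \in L]| <=
       #|[set L in M | (p \in L) && (L \subset S)]| + #|[set L in G | p \in L]|.
      apply: leq_trans (leq_card_setU _ _); apply/subset_leq_card/subsetP => L.
      rewrite !inE => /andP[-> Lp]; rewrite Lp /=.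
      case: (L \subset S) => //=; rewrite andbT.
      by apply/set0Pn; exists p; rewrite !inE Lp Sp Pp.
    apply: halve_degree (ltnW q1) _ leS leD.
    by apply: leq_trans (deg p Pp) _; rewrite leq_mul2l degE orbT.
  rewrite leq_mul2l; apply/orP; right.
  rewrite (double_count (fun p (L : {set 'rV[F]_n}) => p \in L)) -sum1_card.
  apply: leq_sum => L; rewrite inE => /and3P[/dM[lL _] nLS _].
  apply: leq_trans (card_line_cap lL plS nLS).
  by apply/subset_leq_card/subsetP => p; rewrite !inE => /andP[/andP[-> _] ->].
(* The (r+1)-planes R through S distribute the lines of G and cut P \ S into
   disjoint pieces PR R. *)
have leG2 : #|G| * #|F| ^ 2 <= C2 * #|P| * #|F| ^ r.
  pose RR := [set R : {set 'rV[F]_n} | `[< is_plane r.+1 R >] & S \subset R].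
  pose GR (R : {set 'rV[F]_n}) := [set L in G | L \subset R].
  pose PR (R : {set 'rV[F]_n}) := (R :&: P) :\: S.
  have leR R : R \in RR -> #|GR R| * #|F| ^ 2 <= C2 * #|PR R| * #|F| ^ r.
    rewrite inE => /andP[/asboolP plR sSR]; apply: ub.
      move=> L; rewrite !inE => /andP[/and3P[/dM[lL dL] nLS _] sLR]; split=> //.
      have : #|L :&: P| <= #|L :&: PR R| + #|L :&: S|.
        apply: leq_trans (leq_card_setU _ _); apply/subset_leq_card/subsetP => x.
        rewrite !inE => /andP[Lx Px]; rewrite Lx Px (subsetP sLR) //=.
        by rewrite andbT orNb.
      have := card_line_cap lL plS nLS; nia.
    apply: leq_trans (wolff R plR); apply/subset_leq_card/subsetP => L.
    by rewrite !inE => /andP[/and3P[->]].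
  have leGR : #|G| <= \sum_(R in RR) #|GR R|.
    rewrite (double_count (fun (R : {set 'rV[F]_n}) (L : {set 'rV[F]_n}) => L \subset R)).
    rewrite -sum1_card; apply: leq_sum => L.
    rewrite inE => /and3P[/dM[lL _] nLS /set0Pn[p]].
    rewrite !inE => /andP[/andP[Lp Sp] _].
    have [R [plR sSR sLR]] := plane_join_line plS lL Sp Lp nLS.
    by apply/card_gt0P; exists R; rewrite !inE sSR sLR !andbT; apply/asboolP.
  have lePR : \sum_(R in RR) #|PR R| <= #|P|.
    apply: (@leq_trans (\sum_(p in P) 1)); last by rewrite sum1_card.
    apply: (@leq_trans (\sum_(R in RR) #|[set p in P | p \in R :\: S]|)).
      apply: leq_sum => R _; apply/subset_leq_card/subsetP => p.
      by rewrite !inE => /and3P[-> -> ->].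
    rewrite (double_count (fun (R : {set 'rV[F]_n}) p => p \in R :\: S)).
    apply: leq_sum => p Pp; rewrite leqNgt; apply/negP => /card_gt1P[A [B []]].
    rewrite !inE => /andP[/andP[/asboolP plA sSA] /andP[nSp Ap]].
    move=> /andP[/andP[/asboolP plB sSB] /andP[_ Bp]] /eqP[].
    exact: (plane_succ_cap plS plA plB sSA sSB nSp Ap Bp).
  apply: (@leq_trans (\sum_(R in RR) C2 * #|PR R| * #|F| ^ r)).
    by apply: leq_trans (leq_mul leGR (leqnn _)) _; rewrite big_distrl; apply: leq_sum.
  by rewrite -big_distrl -big_distrr /= leq_mul2r leq_mul2l lePR !orbT.
have qr0 : 0 < #|F| ^ r by rewrite expn_gt0 ltnW.
rewrite -(leq_pmul2l qr0).
apply: (@leq_trans (C1 * #|S :&: P| * (h * #|F| ^ 2))); first by rewrite leq_mul2r fullS orbT.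
apply: (@leq_trans (C1 * (2 * D) * (#|G| * #|F| ^ 2))).
  have -> : C1 * #|S :&: P| * (h * #|F| ^ 2) = C1 * #|F| ^ 2 * (#|S :&: P| * h) by lia.
  have -> : C1 * (2 * D) * (#|G| * #|F| ^ 2) = C1 * #|F| ^ 2 * (2 * D * #|G|) by lia.
  by rewrite leq_mul2l leG orbT.
apply: leq_trans (leq_mul (leqnn _) leG2) _; lia.
Qed.

(** * Planes that are rich in lines are full of points *)

Lemma subset_of_card (T : finType) (A : {set T}) m :
  m <= #|A| -> exists2 B : {set T}, B \subset A & #|B| = m.
Proof.
elim: m => [_|m IHm ltm]; first by exists set0; rewrite ?sub0set ?cards0.
have [B sBA cB] := IHm (ltnW ltm).
have /set0Pn[x /setDP[Ax nBx]] : A :\: B != set0.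
  by rewrite -card_gt0 cardsD (setIidPr sBA) cB subn_gt0.
exists (x |: B); last by rewrite cardsU1 nBx cB.
by rewrite subUset sub1set Ax.
Qed.

Lemma last_true (Q : nat -> Prop) k :
  Q 1 -> ~ Q k.+1 -> exists r, [/\ 0 < r, r <= k, Q r & ~ Q r.+1].
Proof.
move=> Q1; elim: k => // k IHk nQ; have [Qk|nQk] := EM (Q k.+1).
  by exists k.+1.
by have [r [r0 lek Qr nQr]] := IHk nQk; exists r; split=> //; apply: leqW.
Qed.

(** The constant is required to serve all dimensions r <= k at once, because the
    dimension in which it is used depends on M. *)
Definition line_unions (k : nat) : Prop :=
  forall a, exists C, forall r, 0 < r <= k ->
    forall (F : finFieldType) n, union_bound F n a C r.

(** Since 2r - 3 = 2(r-1) - 1, this is [union_bound] in dimension r - 1 for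
    exactly q^(2r-3) of the lines in S: q^(2r-3) q^(2-(r-1)) is q^r.  For r = 1 the truncated exponent is 0, and a single dense line
    suffices. *)
Lemma full_plane k : line_unions k ->
  forall a, exists C, forall r, 0 < r <= k.+1 ->
    forall (F : finFieldType) n (S : {set 'rV[F]_n}) M P,
    dense_lines a M P ->
    #|F| ^ (2 * r - 3) <= #|[set L in M | L \subset S]| ->
    #|F| ^ r <= C * #|S :&: P|.
Proof.
move=> luk a; have [C hC] := luk a; exists (C + a) => r /andP[r0 rk] F n S M P dM.
have q1 : 1 < #|F| := card_finNzRing_gt1 F.
case: r r0 rk => // -[_ _|r _ rk] big.
  have /card_gt0P[L] := big; rewrite inE => /andP[/dM[_ dL] sLS].
  rewrite expn1; apply: leq_trans dL _.
  by rewrite leq_mul ?leq_addl ?subset_leq_card ?setSI.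
have [N sN cN] := subset_of_card big.
have dN := dense_linesS sN (dense_linesI (S := S) dM).
have := hC r.+1 _ F n N _ dN; rewrite cN.
have -> : 2 * r.+2 - 3 = 2 * r.+1 - 1 by lia.
move=> /(_ rk (leqnn _)); rewrite -expnD.
have -> : 2 * r.+1 - 1 + 2 = r.+2 + r.+1 by lia.
rewrite expnD leq_pmul2r ?expn_gt0 ?(ltnW q1) // => le1.
by apply: leq_trans le1 _; rewrite leq_mul2r leq_addr orbT.
Qed.

(** * Unions of lines under the plane Wolff axiom *)

(** The hypothesis C <= q makes dense lines have many points; with only one
    point on each line, a bush through a single point would be a
    counterexample of unbounded size as n grows. *)
Lemma wolff_bound k : line_unions k ->
  forall a, exists C, forall (F : finFieldType) n
    (M : {set {set 'rV[F]_n}}) (P : {set 'rV[F]_n}),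
    dense_lines a M P -> plane_Wolff k.+1 M -> C <= #|F| ->
    #|M| * #|F| ^ 3 <= C * #|P| * #|F| ^ k.+1 \/
    #|M| * #|F| ^ 3 <= C * #|P| ^ 2.
Proof.
move=> luk a.
have [C1 fullC] := full_plane luk (4 * a).
have [C2 ubC] := luk (2 * (4 * a)).
exists (16 * a + 8 * a * C1 * C2) => F n M P dM wolffM leC.
have q1 : 1 < #|F| := card_finNzRing_gt1 F.
have [M0|M0] := posnP #|M|; first by left; rewrite M0.
(* The average multiplicity |M| q / |P| is compared with a multiple of q^(k-1):
   below it the first bound holds, above it the hairbrush works for all r <= k. *)
have [lowdeg|highdeg] := ltnP (#|M| * #|F| ^ 2) (16 * a * #|P| * #|F| ^ k).
  left; rewrite expnSr mulnA (expnSr _ k) [leqRHS]mulnA leq_mul2r; apply/orP; right.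
  apply: leq_trans (ltnW lowdeg) _.
  by rewrite leq_mul2r leq_mul2r leq_addr !orbT.
right.
pose I := \sum_(L in M) #|[set p in P | p \in L]|.
have leI : #|M| * #|F| <= a * I.
  rewrite /I big_distrr -sum_nat_const /=; apply: leq_sum => L LM.
  have [_] := dM L LM; congr (_ <= a * _).
  by apply: eq_card => p; rewrite !inE andbC.
have P0 : 0 < #|P|.
  rewrite lt0n; apply: contraTneq leI => /eqP; rewrite cards_eq0 => /eqP EP.
  rewrite /I big1 => [|L _]; first by rewrite muln0 -ltnNge muln_gt0 M0 ltnW.
  by rewrite EP; apply: eq_card0 => p; rewrite !inE.
(* The points kept have multiplicity at least |M| q / (4 a |P|), and the lines
   kept have at least q / (4 a) of them. *)
have /prune[M' [P' [sM' M'0 sP' hM' hP']]] :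
    #|F| * #|P| * #|M| + #|M| * #|F| * #|P| < 4 * a * #|P| * I.
  have : 0 < #|M| * #|F| * #|P| by rewrite !muln_gt0 M0 P0 ltnW.
  have := leq_mul leI (leqnn #|P|); nia.
have dM' : dense_lines (4 * a) M' P'.
  move=> L LM'; split; first by case: (dM L (subsetP sM' _ LM')).
  have := hM' L LM'; rewrite mulnAC leq_pmul2r //; congr (_ <= _ * _).
  by apply: eq_card => p; rewrite !inE andbC.
pose Q r := exists S : {set 'rV[F]_n},
  is_plane r S /\ #|F| ^ (2 * r - 3) <= #|[set L in M' | L \subset S]|.
have [||r [r0 rk [S [plS richS]] nQ]] := @last_true Q k.
- have [L LM'] := set0Pn _ M'0; exists L; split; first by case: (dM' L LM').
  by apply/card_gt0P; exists L; rewrite inE LM' subxx.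
- move=> [S [plS]]; apply/negP; rewrite -ltnNge.
  apply: leq_ltn_trans (wolffM S plS); apply/subset_leq_card/subsetP => L.
  by rewrite !inE => /andP[/(subsetP sM')-> ->].
have fullS : #|F| ^ r <= C1 * #|S :&: P'|.
  by apply: (fullC r) dM' richS; rewrite r0 leqW.
have le1 : #|M| * #|F| * #|F| ^ 2 <= 2 * (4 * a * #|P|) * C1 * C2 * #|P'|.
  apply: (hairbrush (h := #|M| * #|F|) plS dM' _ hP' _ fullS) => [||R plR|].
  - by apply: leq_trans leC; lia.
  - rewrite -[leqRHS]mulnA mulnn; apply: leq_trans highdeg.
    rewrite !mulnA leq_mul2l; apply/orP; right.
    by rewrite leq_pexp2l // ltnW.
  - have -> : 2 * r - 1 = 2 * r.+1 - 3 by lia.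
    by rewrite leqNgt; apply/negP => /ltnW big; apply: nQ; exists R.
  - by move=> N T dN; apply: (ubC r) dN; rewrite r0.
apply: (@leq_trans (8 * a * C1 * C2 * #|P| ^ 2)); last first.
  by rewrite leq_mul2r leq_addl orbT.
rewrite (expnS _ 2) mulnA; apply: leq_trans le1 _.
have := leq_mul (leqnn (8 * a * C1 * C2 * #|P|)) (subset_leq_card sP'); lia.
Qed.

(** From m q^3 <= C p^2 and m <= q^(2k+1), multiply: m^2 q^4 <= C p^2 q^(2k+2). *)
Lemma geometric_mean_bound m m0 q k C p :
  m <= 2 * m0 -> m <= q ^ (2 * k + 1) -> m0 * q ^ 3 <= C * p ^ 2 ->
  m * q ^ 2 <= 2 * C * p * q ^ k.+1.
Proof.
move=> lem lemq le0; rewrite -(@leq_exp2r _ _ 2) //.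
have E2 : q ^ (2 * k + 1) * q ^ 4 = q ^ 3 * q ^ (2 * k.+1).
  by rewrite -!expnD; congr (_ ^ _); lia.
apply: (@leq_trans (2 * (m0 * q ^ 3) * q ^ (2 * k.+1))).
  have -> : (m * q ^ 2) ^ 2 = m * m * q ^ 4 by rewrite expnMn -expnM mulnn.
  apply: leq_trans (leq_mul (leq_mul lem lemq) (leqnn (q ^ 4))) _.
  by rewrite -[leqLHS]mulnA E2 [leqLHS]mulnA -[X in X * _ <= _]mulnA.
apply: (@leq_trans (2 * (C * p ^ 2) * q ^ (2 * k.+1))).
  by rewrite leq_mul2r leq_mul2l le0 !orbT.
rewrite !expnMn -expnM [k.+1 * 2]mulnC leq_mul2r; apply/orP; right; nia.
Qed.

(** The step also covers k = 0, where the rich 1-planes are the lines of M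
    themselves and the argument is Cordoba's for lines. *)
Lemma line_unions_succ k : line_unions k -> line_unions k.+1.
Proof.
move=> luk a; have [CT hT] := luk a; have [CW hW] := wolff_bound luk a.
have [C1 hF] := full_plane luk a.
pose C := CT + CW ^ (2 * k + 3) + 2 * CW + 4 * (C1 * C1.+1).
exists C => r /andP[r0 rk] F n M P dM leM.
have q1 : 1 < #|F| := card_finNzRing_gt1 F.
suff [B leBC leB] : exists2 B, B <= C & #|M| * #|F| ^ 2 <= B * #|P| * #|F| ^ r.
  by apply: leq_trans leB _; rewrite !leq_mul2r leBC !orbT.
have [M0|/card_gt0P[L0 L0M]] := posnP #|M|; first by exists 0; rewrite ?M0.
have P0 : 0 < #|P|.
  have [_] := dM _ L0M; rewrite lt0n; apply: contraTneq => /eqP.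
  by rewrite cards_eq0 => /eqP->; rewrite setI0 cards0 muln0 -ltnNge ltnW.
have [rk' | kr] := leqP r k.
  by exists CT; [rewrite /C; lia | apply: hT dM leM; rewrite r0].
have {kr rk r0} Er : r = k.+1 by apply/eqP; rewrite eqn_leq rk.
rewrite {r}Er in leM *.
have Ek : 2 * k.+1 - 1 = 2 * k + 1 by lia.
rewrite {}Ek in leM.
have leM2 : #|M| * #|F| ^ 2 <= #|F| ^ (2 * k + 3).
  have -> : 2 * k + 3 = 2 * k + 1 + 2 by lia.
  by rewrite expnD leq_mul2r leM orbT.
(* bounded fields are absorbed by the constant *)
have [ltq|leCWq] := ltnP #|F| CW.
  exists (CW ^ (2 * k + 3)); first by rewrite /C; lia.
  apply: leq_trans leM2 _; apply: (@leq_trans (CW ^ (2 * k + 3))).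
    by rewrite leq_exp2r ?(ltnW ltq) // addnC.
  by rewrite -mulnA leq_pmulr // muln_gt0 P0 expn_gt0 ltnW.
pose RR := [set S : {set 'rV[F]_n} | `[< is_plane k.+1 S >] &
  #|F| ^ (2 * k.+1 - 3) <= #|[set L in M | L \subset S]|].
pose Mbad := [set L in M | [exists S in RR, L \subset S]].
have wolffM : plane_Wolff k.+1 (M :\: Mbad).
  move=> R plR; rewrite ltnNge; apply/negP => big.
  have /card_gt0P[L] : 0 < #|[set L in M :\: Mbad | L \subset R]|.
    by apply: leq_trans big; rewrite expn_gt0 ltnW.
  rewrite !inE => /andP[/andP[nbad LM] sLR]; case/negP: nbad; rewrite LM /=.
  apply/exists_inP; exists R => //; rewrite inE; apply/andP; split; first exact/asboolP.
  apply: leq_trans big _; apply/subset_leq_card/subsetP => L'.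
  by rewrite !inE => /andP[/andP[_ ->] ->].
have cM : #|M| = #|Mbad| + #|M :\: Mbad|.
  rewrite -(cardsID Mbad M); congr (#|pred_of_set _| + _).
  by apply/setIidPr/subsetP => L; rewrite inE => /andP[].
have [leW|leB] := leqP #|Mbad| #|M :\: Mbad|.
  have {cM leW} leW : #|M| <= 2 * #|M :\: Mbad| by lia.
  exists (2 * CW); first by rewrite /C; lia.
  have [] := hW F n _ P (dense_linesS (subsetDl _ _) dM) wolffM leCWq.
    have : #|M :\: Mbad| * #|F| ^ 2 <= #|M :\: Mbad| * #|F| ^ 3.
      by rewrite leq_mul2l leq_pexp2l ?orbT // ltnW.
    have := leq_mul leW (leqnn (#|F| ^ 2)); lia.
  exact: geometric_mean_bound.
have {cM leB} leB : #|M| <= 2 * #|Mbad| by lia.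
exists (4 * (C1 * C1.+1)); first by rewrite /C; lia.
have leRR : #|Mbad| * #|F| ^ 2 <= #|RR| * (2 * #|F| ^ (2 * k.+1)).
  apply: (@leq_trans (\sum_(S in RR) #|[set L in Mbad | L \subset S]| * #|F| ^ 2)).
    rewrite -big_distrl /= leq_mul2r; apply/orP; right.
    rewrite (double_count (fun (S L : {set 'rV[F]_n}) => L \subset S)) -sum1_card.
    apply: leq_sum => L; rewrite inE => /andP[_ /exists_inP[S RS sLS]].
    by apply/card_gt0P; exists S; rewrite inE RS.
  rewrite -sum_nat_const; apply: leq_sum => S; rewrite inE => /andP[/asboolP plS _].
  apply: card_lines_in plS _ => L; rewrite !inE => /andP[/andP[LM _] sLS].
  by split=> //; case: (dM L LM).
(* at most q of the rich planes are used: with more of them, overlaps could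
   dominate, while q full planes already have about q^(k+2) points *)
have [A sA cA] : exists2 A : {set {set 'rV[F]_n}}, A \subset RR & #|A| = minn #|RR| #|F|.
  exact/subset_of_card/geq_minl.
have : #|A| * (#|F| * #|F| ^ k) <= C1 * C1.+1 * #|P|.
  apply: cordoba => [|S /(subsetP sA)|S S' /(subsetP sA)+ /(subsetP sA)].
  - by rewrite cA geq_minr.
  - rewrite inE -expnS => /andP[/asboolP plS richS].
    by apply: (hF k.+1) dM richS; rewrite leqnn.
  - rewrite !inE => /andP[/asboolP plS _] /andP[/asboolP plS' _].
    move=> /(card_plane_cap_neq plS plS').
    by rewrite expnSr leq_pmul2r // ltnW.
rewrite -expnS => leA.
have leMA : #|M| * #|F| ^ 2 <= 4 * #|A| * #|F| ^ (2 * k.+1).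
  rewrite cA; have [_|_] := leqP #|RR| #|F|.
    by have := leq_mul leB (leqnn (#|F| ^ 2)); lia.
  apply: leq_trans leM2 _; rewrite -mulnA -expnS.
  have -> : 2 * k + 3 = (2 * k.+1).+1 by lia.
  by rewrite leq_pmull.
apply: leq_trans leMA _.
rewrite [X in _ ^ X]mul2n -addnn expnD.
have := leq_mul leA (leqnn (4 * #|F| ^ k.+1)); lia.
Qed.

Lemma line_unions_all k : line_unions k.
Proof.
by elim: k => [a|k]; [exists 0 => r; case: r | exact: line_unions_succ].
Qed.

(** * The theorem *)

Local Open Scope ring_scope.

Theorem theorem1p4 (R : realType) (d : nat) (hd : (2 < d)%N)
    (alpha : R)
    (halpha1 : 2 * (d%:R - 1) - 1 < alpha)
    (halpha2 : alpha < 2 * (d%:R - 1) + 1)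
    (n : nat) (hn : (0 < n)%N) :
  exists c : R, 0 < c /\
    forall (F : finFieldType) (LL : {set {set 'rV[F]_n}}),
      (forall L, L \in LL -> is_line L) ->
      #|F|%:R `^ alpha <= #|LL|%:R ->
      plane_Wolff d LL ->
      c * #|F|%:R `^ ((alpha + 3) / 2) <= #|\bigcup_(L in LL) L|%:R.
Proof.
case: d hd halpha1 halpha2 => // k _ halpha1 _.
have [C hC] := wolff_bound (line_unions_all k) 1.
set b := (alpha + 3) / 2.
have hb : k.+1%:R <= b by rewrite /b; lra.
have b0 : 0 <= b by apply: le_trans hb; rewrite ler0n.
have C0 : 0 < C.+1%:R :> R by rewrite ltr0n.
have C1 : 1 <= C.+1%:R :> R by rewrite ler1n.
exists ((C.+1%:R * C.+1%:R `^ b)^-1); split.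
  by rewrite invr_gt0 mulr_gt0 ?powR_gt0.
move=> F LL lines leLL wolff; set P := \bigcup_(L in LL) L.
have q1 : (1 < #|F|)%N := card_finNzRing_gt1 F.
have q0 : 0 < #|F|%:R :> R by rewrite ltr0n ltnW.
have qr1 : 1 <= #|F|%:R :> R by rewrite ler1n ltnW.
have Cb1 : 1 <= C.+1%:R `^ b.
  by rewrite -[leLHS](powRr0 C.+1%:R); apply: ler_powR.
have dLL : dense_lines 1 LL P.
  move=> L LLL; split; first exact: lines.
  rewrite mul1n (setIidPl _) ?(card_plane (lines L LLL)) ?expn1 //.
  exact: bigcup_sup LLL.
have P0 : (0 < #|P|)%N.
  have : 0 < #|LL|%:R :> R by apply: lt_le_trans leLL; rewrite powR_gt0.
  rewrite ltr0n => /card_gt0P[L LLL]; have [_] := dLL L LLL; rewrite mul1n => leF.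
  apply: leq_trans (subset_leq_card (subsetIr L P)).
  by apply: leq_trans leF; apply: ltnW.
rewrite -(ler_pM2l (mulr_gt0 C0 (lt_le_trans ltr01 Cb1))) mulrA mulfV ?mul1r; last first.
  by rewrite gt_eqF // mulr_gt0 ?powR_gt0.
(* for a bounded field it is enough that P is nonempty *)
have [ltq|leCq] := ltnP #|F| C.
  apply: (@le_trans _ _ (C.+1%:R `^ b)).
    by apply: ge0_ler_powR; rewrite ?nnegrE ?ler0n // ler_nat ltnW // ltnW.
  rewrite -[leLHS]mul1r -[leLHS]mulr1 ler_pM ?mulr_ge0 ?ler_wpM2r ?powR_ge0 //.
  by rewrite ler1n.
have leP : #|F|%:R `^ b <= C.+1%:R * #|P|%:R.
  have Eq : #|F|%:R `^ b * #|F|%:R `^ b = #|F|%:R `^ alpha * #|F|%:R ^+ 3 :> R.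
    rewrite -powR_mulrn ?ler0n // -!powRD; first by congr (_ `^ _); rewrite /b; lra.
      by rewrite (gt_eqF q0) implybT.
    by rewrite (gt_eqF q0) implybT.
  have le3 : #|F|%:R `^ b * #|F|%:R `^ b <= (#|LL| * #|F| ^ 3)%N%:R :> R.
    by rewrite Eq natrM natrX ler_wpM2r ?exprn_ge0 ?ler0n.
  have qb0 : 0 < #|F|%:R `^ b :> R by rewrite powR_gt0.
  have [] := hC F n LL P dLL wolff leCq; rewrite -(ler_nat R) => /(le_trans le3).
    move=> le4; rewrite -(ler_pM2r qb0); apply: le_trans le4 _; rewrite !natrM.
    apply: ler_pM; rewrite ?mulr_ge0 ?ler0n ?ler_wpM2r ?ler_nat //.
    by rewrite natrX -powR_mulrn ?ler0n // ler_powR.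
  move=> leC; rewrite -(@ler_pXn2r _ 2) ?nnegrE ?mulr_ge0 ?powR_ge0 ?ler0n //.
  rewrite expr2; apply: le_trans leC _; rewrite natrM natrX exprMn.
  rewrite ler_wpM2r ?exprn_ge0 ?ler0n // expr2.
  apply: (@le_trans _ _ C.+1%:R); first by rewrite ler_nat.
  by rewrite -[leLHS]mul1r ler_wpM2r.
apply: le_trans leP _; rewrite -mulrA ler_wpM2l ?ler0n //.
by rewrite -[leLHS]mul1r ler_wpM2r ?ler0n.
Qed.
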